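(* The contravariant functors $\mathcal{F}$ and $\mathcal{C}$ between the category $\mathsf{OL}$ of ortholattices and the category $\mathsf{OS}$ of orthospaces form an adjunction $\mathcal{F}\dashv\mathcal{C}$ between $\mathsf{OL}$ and $\mathsf{OS}^{op}$; that is, $\mathcal{F}:\mathsf{OL}\to\mathsf{OS}^{op}$ is left adjoint to $\mathcal{C}:\mathsf{OS}^{op}\to\mathsf{OL}$, with bijections $\mathrm{Hom}_{\mathsf{OL}}(L,\mathcal{C}(X))\cong\mathrm{Hom}_{\mathsf{OS}}(X,\mathcal{F}(L))$ natural in the ortholattice $L$ and the orthospace $X$.
   Context: An ortholattice is a bounded lattice with an order-inverting complementation $'$ of period two; $\mathsf{OL}$ is the category of ortholattices and their homomorphisms. An orthoframe is a set $X$ with an irreflexive symmetric relation $\perp$. For $S\subseteq X$, $S^\perp=\{y\in X:x\perp y\text{ for all }x\in S\}$; $S$ is bi-orthogonally closed if $S=S^{\perp\perp}$. An orthospace $(X,\perp,\le,\tau)$ is an orthoframe $(X,\perp)$ with a partial ordering $\le$ and a compact topology $\tau$ such that, writing $\mathcal{C}(X)$ for the set of clopen bi-orthogonally closed subsets of $X$: (1) if $x\nleq y$ then there is $U\in\mathcal{C}(X)$ with $x\in U$, $y\notin U$; (2) if $x\perp z$ and $x\le y$ then $y\perp z$; (3) if $U\in\mathcal{C}(X)$ then $U^\perp\in\mathcal{C}(X)$; (4) if $x\perp y$ then there is $U\in\mathcal{C}(X)$ with $x\in U$, $y\in U^\perp$. An orthospace morphism $\phi:P\to X$ is a continuous map such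 that: if $\phi(p)\perp\phi(q)$ then $p\perp q$; and if $x\not\perp\phi(p)$ then there exists $q$ with $q\not\perp p$ and $\phi(q)\in\{x\}^{\perp\perp}$. $\mathsf{OS}$ is the category of orthospaces and their morphisms. For an ortholattice $L$, $\mathcal{F}(L)$ is the orthospace of proper non-empty filters of $L$, with $x\perp y$ iff there is a non-zero $a\in L$ with $a\in x$ and $a'\in y$, ordered by inclusion, with topology having as sub-basis the sets $\{x:a\in x\}$ ($a\in L$) and their set-theoretic complements. For an orthospace $X$, $\mathcal{C}(X)$ is the ortholattice of clopen bi-orthogonally closed subsets ordered by inclusion with orthocomplement $U\mapsto U^\perp$ (meets are intersections, and $U\vee V=(U\cup V)^{\perp\perp}$). On morphisms, $\mathcal{F}(f)=f^{-1}[\,\cdot\,]$ for an ortholattice homomorphism $f$ and $\mathcal{C}(\phi)=\phi^{-1}[\,\cdot\,]$ for an orthospace morphism $\phi$. It is known that these are contravariant functors. *)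

(* Defs.v *)
From HB Require Import structures.
From mathcomp Require Import all_boot all_order finmap.
From mathcomp Require Import all_classical.
From mathcomp Require Import topology.

Set Implicit Arguments.
Unset Strict Implicit.
Unset Printing Implicit Defensive.

Import Order.Theory.

Local Open Scope order_scope.
Local Open Scope classical_set_scope.

Record category := Category {
  ob :> Type;
  hom : ob -> ob -> Type;
  cat_id : forall a : ob, hom a a;
  cat_comp : forall a b c : ob, hom b c -> hom a b -> hom a c;
  comp_idl : forall (a b : ob) (f : hom a b), cat_comp (cat_id b) f = f;
  comp_idr : forall (a b : ob) (f : hom a b), cat_comp f (cat_id a) = f;
  comp_assoc : forall (a b c d : ob)
      (h : hom c d) (g : hom b c) (f : hom a b),
    cat_comp h (cat_comp g f) = cat_comp (cat_comp h g) f
}.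
Arguments hom {_} _ _.
Arguments cat_id {_} a.
Arguments cat_comp {_ a b c} _ _.

Definition opposite (C : category) : category := {|
  ob := C;
  hom := fun a b => @hom C b a;
  cat_id := fun a => @cat_id C a;
  cat_comp := fun a b c g f => @cat_comp C c b a f g;
  comp_idl := fun a b f => @comp_idr C b a f;
  comp_idr := fun a b f => @comp_idl C b a f;
  comp_assoc := fun a b c d h g f => esym (@comp_assoc C d c b a f g h)
|}.

Record functor (C D : category) := Functor {
  fob :> C -> D;
  fmap : forall a b : C, hom a b -> hom (fob a) (fob b);
  fmap_id : forall a : C, fmap (cat_id a) = cat_id (fob a);
  fmap_comp : forall (a b c : C) (g : hom b c) (f : hom a b),
    fmap (cat_comp g f) = cat_comp (fmap g) (fmap f)
}.
Arguments fmap {C D} _ {a b} _.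

Definition left_adjoint (C D : category) (F : functor C D) (G : functor D C)
    : Prop :=
  exists Phi : forall (c : C) (d : D), hom (F c) d -> hom c (G d),
    (forall (c : C) (d : D), bijective (Phi c d)) /\
    (forall (c c' : C) (d d' : D)
        (u : hom c' c) (v : hom d d') (h : hom (F c) d),
      Phi c' d' (cat_comp v (cat_comp h (fmap F u))) =
      cat_comp (fmap G v) (cat_comp (Phi c d h) u)).

HB.mixin Record TBLattice_isOrthoLattice (d : Order.disp_t) L
    & Order.TBLattice d L := {
  ocompl : L -> L;
  ocomplK : involutive ocompl;
  ocompl_anti : forall x y : L, x <= y -> ocompl y <= ocompl x;
  meetxoc : forall x : L, (x `&` ocompl x)%O = \bot;
  joinxoc : forall x : L, (x `|` ocompl x)%O = \top
}.

#[short(type="orthoLatticeType")]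
HB.structure Definition OrthoLattice (d : Order.disp_t) :=
  { L of Order.TBLattice d L & TBLattice_isOrthoLattice d L }.

HB.mixin Record isOrthoComplMorphism (d : Order.disp_t)
    (L : orthoLatticeType d) (d' : Order.disp_t) (M : orthoLatticeType d')
    (f : L -> M) := {
  omorphoc : {morph f : x / ocompl x}
}.

#[short(type="orthoLatticeMorphism")]
HB.structure Definition OrthoLatticeMorphism (d : Order.disp_t)
    (L : orthoLatticeType d) (d' : Order.disp_t) (M : orthoLatticeType d') :=
  { f of @Order.LatticeMorphism d L d' M f
       & @Order.TBLatticeMorphism d L d' M f
       & @isOrthoComplMorphism d L d' M f }.

HB.mixin Record isOrthoFrame (X : Type) := {
  perp : X -> X -> Prop;
  perp_irr : forall x : X, ~ perp x x;
  perp_sym : forall x y : X, perp x y -> perp y x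
}.

#[short(type="orthoFrameType")]
HB.structure Definition OrthoFrame := { X of isOrthoFrame X }.

Definition perpset (X : orthoFrameType) (S : set X) : set X :=
  [set y | forall x, S x -> perp x y].

Definition biclosed (X : orthoFrameType) (S : set X) : Prop :=
  S = perpset (perpset S).

#[short(type="orthoPreSpaceType")]
HB.structure Definition OrthoPreSpace (d : Order.disp_t) :=
  { X of Topological X & Order.POrder d X & isOrthoFrame X }.

Definition clopen_biclosed (d : Order.disp_t) (X : orthoPreSpaceType d)
  (U : set X) : Prop := clopen U /\ biclosed U.

HB.mixin Record OrthoPreSpace_isOrthoSpace (d : Order.disp_t) X
    & OrthoPreSpace d X := {
  orthospace_compact : compact [set: X];
  orthospace_sep : forall x y : X, ~ (x <= y) ->
    exists U : set X, [/\ clopen_biclosed U, U x & ~ U y];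
  orthospace_perp_le : forall x y z : X, perp x z -> x <= y -> perp y z;
  orthospace_perpset : forall U : set X,
    clopen_biclosed U -> clopen_biclosed (perpset U);
  orthospace_perp_sep : forall x y : X, perp x y ->
    exists U : set X, [/\ clopen_biclosed U, U x & perpset U y]
}.

#[short(type="orthoSpaceType")]
HB.structure Definition OrthoSpace (d : Order.disp_t) :=
  { X of OrthoPreSpace d X & OrthoPreSpace_isOrthoSpace d X }.

Record orthoSpaceMorphism (d : Order.disp_t) (P : orthoSpaceType d)
    (d' : Order.disp_t) (X : orthoSpaceType d') := OrthoSpaceMorphism {
  osm_fun :> P -> X;
  osm_continuous : continuous osm_fun;
  osm_perp : forall p q : P, perp (osm_fun p) (osm_fun q) -> perp p q;
  osm_back : forall (x : X) (p : P), ~ perp x (osm_fun p) ->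
    exists q : P, ~ perp q p /\ perpset (perpset [set x]) (osm_fun q)
}.

(* The display is a phantom parameter of MathComp orders; bundling it with
   the carrier makes every ortholattice, whatever its display, an object. *)
Record ol_object := OLObject {
  ol_disp : Order.disp_t;
  ol_sort :> orthoLatticeType ol_disp
}.

Section OLMorphisms.
Context (d : Order.disp_t) (L : orthoLatticeType d).
Context (d' : Order.disp_t) (M : orthoLatticeType d').
Context (d'' : Order.disp_t) (N : orthoLatticeType d'').

Fact idfun_omorphoc : {morph @idfun L : x / ocompl x}. Proof. by []. Qed.
HB.instance Definition _ :=
  isOrthoComplMorphism.Build d L d L idfun idfun_omorphoc.

Fact comp_omorphoc (g : orthoLatticeMorphism M N)
  (f : orthoLatticeMorphism L M) : {morph g \o f : x / ocompl x}.
Proof. by move=> x; rewrite /= !omorphoc. Qed.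
HB.instance Definition _ (g : orthoLatticeMorphism M N)
    (f : orthoLatticeMorphism L M) :=
  isOrthoComplMorphism.Build d L d'' N (g \o f) (comp_omorphoc g f).

Lemma olm_eq (f g : orthoLatticeMorphism L M) : f =1 g -> f = g.
Proof.
case: f => f [[a1] [a2] [a3] [a4] [a5] [a6]].
case: g => g [[b1] [b2] [b3] [b4] [b5] [b6]] /= fg.
have {}fg : f = g by apply/funext.
subst g.
by move: b1 b2 b3 b4 b5 b6 => b1 b2 b3 b4 b5 b6;
  rewrite (Prop_irrelevance a1 b1) (Prop_irrelevance a2 b2)
    (Prop_irrelevance a3 b3) (Prop_irrelevance a4 b4)
    (Prop_irrelevance a5 b5) (Prop_irrelevance a6 b6).
Qed.

End OLMorphisms.

Definition ol_id (L : ol_object) : orthoLatticeMorphism L L :=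
  HB.pack_for (orthoLatticeMorphism L L) (@idfun L).

Definition ol_comp (L M N : ol_object) (g : orthoLatticeMorphism M N)
    (f : orthoLatticeMorphism L M) : orthoLatticeMorphism L N :=
  HB.pack_for (orthoLatticeMorphism L N) (g \o f).

Definition OL : category := {|
  ob := ol_object;
  hom := fun L M => orthoLatticeMorphism L M;
  cat_id := ol_id;
  cat_comp := ol_comp;
  comp_idl := fun L M f => olm_eq (f := ol_comp (ol_id M) f) (frefl f);
  comp_idr := fun L M f => olm_eq (f := ol_comp f (ol_id L)) (frefl f);
  comp_assoc := fun L M N K h g f =>
    olm_eq (f := ol_comp h (ol_comp g f)) (g := ol_comp (ol_comp h g) f)
      (frefl _)
|}.

Record os_object := OSObject {
  os_disp : Order.disp_t;
  os_sort :> orthoSpaceType os_disp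
}.

Section Perpset.
Context (X : orthoFrameType).
Implicit Types (S T : set X) (x y : X).

Lemma perpset_anti S T : S `<=` T -> perpset T `<=` perpset S.
Proof. by move=> ST y Ty x /ST; apply: Ty. Qed.

Lemma sub_perpset2 S : S `<=` perpset (perpset S).
Proof. by move=> x Sx y Sy; apply: perp_sym; apply: Sy. Qed.

Lemma perpset3 S : perpset (perpset (perpset S)) = perpset S.
Proof.
by apply/seteqP; split; [apply: perpset_anti|]; apply: sub_perpset2.
Qed.

Lemma perpset_biclosed S : biclosed (perpset S).
Proof. by rewrite /biclosed perpset3. Qed.

Lemma perpsetU S T : perpset (S `|` T) = perpset S `&` perpset T.
Proof.
apply/seteqP; split=> [y STy|y [Sy Ty] x []].
- by split=> x Px; apply: STy; [left|right].
- exact: Sy.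
- exact: Ty.
Qed.

Lemma biclosedI S T : biclosed S -> biclosed T -> biclosed (S `&` T).
Proof.
by move=> bS bT; rewrite bS bT -perpsetU; apply: perpset_biclosed.
Qed.

Lemma perpset0 : perpset (@set0 X) = setT.
Proof. by apply/seteqP; split=> // x _ y []. Qed.

Lemma perpsetT : perpset [set: X] = set0.
Proof. by apply/seteqP; split=> // x /(_ x I) /perp_irr. Qed.

Lemma setI_perpset S : S `&` perpset S = set0.
Proof. by apply/seteqP; split=> // x [Sx /(_ x Sx) /perp_irr]. Qed.

Lemma perpset2_1P x y :
  perpset (perpset [set x]) y <-> forall z, perp x z -> perp z y.
Proof.
split=> [xy z xz|xy z xz]; first by apply: xy => _ ->.
by apply: xy; apply: xz.
Qed.

End Perpset.

Section OSMorphisms.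

Lemma osm_eq (d d' : Order.disp_t) (P : orthoSpaceType d)
  (X : orthoSpaceType d') (f g : orthoSpaceMorphism P X) : f =1 g -> f = g.
Proof.
case: f => f f1 f2 f3; case: g => g g1 g2 g3 /= fg.
have {}fg : f = g by apply/funext.
by subst g; congr OrthoSpaceMorphism.
Qed.

Lemma id_osm_back (P : os_object) (x p : P) : ~ perp x p ->
  exists q : P, ~ perp q p /\ perpset (perpset [set x]) q.
Proof. by move=> xp; exists x; split=> //; apply: sub_perpset2. Qed.

Lemma comp_osm_back (P X Y : os_object) (g : orthoSpaceMorphism X Y)
    (f : orthoSpaceMorphism P X) (y : Y) (p : P) :
  ~ perp y (g (f p)) ->
  exists q : P, ~ perp q p /\ perpset (perpset [set y]) (g (f q)).
Proof.
move=> /osm_back [x [xp /perpset2_1P yx]].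
have [q [qp /perpset2_1P xq]] := osm_back xp.
exists q; split=> //; apply/perpset2_1P => z yz.
apply: contrapT => /osm_back [x' [x'q /perpset2_1P zx']].
apply: x'q; apply: xq; apply: osm_perp.
by apply: zx'; apply: yx.
Qed.

Definition os_id (P : os_object) : orthoSpaceMorphism P P :=
  @OrthoSpaceMorphism _ P _ P idfun (fun _ => cvg_id)
    (fun _ _ => id) (@id_osm_back P).

Definition os_comp (P X Y : os_object) (g : orthoSpaceMorphism X Y)
    (f : orthoSpaceMorphism P X) : orthoSpaceMorphism P Y :=
  @OrthoSpaceMorphism _ P _ Y (g \o f)
    (fun p => continuous_comp (@osm_continuous _ _ _ _ f p)
                              (@osm_continuous _ _ _ _ g (f p)))
    (fun p q gf => osm_perp (osm_perp gf))
    (fun y p => @comp_osm_back P X Y g f y p).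

End OSMorphisms.

Definition OS : category := {|
  ob := os_object;
  hom := fun P X => orthoSpaceMorphism P X;
  cat_id := os_id;
  cat_comp := os_comp;
  comp_idl := fun P X f => osm_eq (f := os_comp (os_id X) f) (frefl f);
  comp_idr := fun P X f => osm_eq (f := os_comp f (os_id P)) (frefl f);
  comp_assoc := fun P X Y Z h g f =>
    osm_eq (f := os_comp h (os_comp g f)) (g := os_comp (os_comp h g) f)
      (frefl _)
|}.

Fact inclusion_display : Order.disp_t. Proof. exact: Order.Disp tt tt. Qed.

Section ClopenBiclosed.
Context (d : Order.disp_t) (X : orthoSpaceType d).

Record clopenBiclosed := ClopenBiclosed {
  cb_set :> set X;
  cbP : clopen_biclosed cb_set
}.

Lemma cb_eq (U V : clopenBiclosed) : cb_set U = cb_set V -> U = V.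
Proof.
case: U V => [U hU] [V hV] /= UV; subst V.
by rewrite (Prop_irrelevance hU hV).
Qed.

HB.instance Definition _ := gen_eqMixin clopenBiclosed.
HB.instance Definition _ := gen_choiceMixin clopenBiclosed.

Definition cb_le (U V : clopenBiclosed) : bool := `[< cb_set U `<=` cb_set V >].

Fact cb_le_refl : reflexive cb_le. Proof. by move=> U; apply/asboolP. Qed.
Fact cb_le_anti : antisymmetric cb_le.
Proof.
move=> U V /andP[/asboolP UV /asboolP VU].
by apply: cb_eq; apply/seteqP.
Qed.
Fact cb_le_trans : transitive cb_le.
Proof.
move=> V U W /asboolP UV /asboolP VW.
by apply/asboolP; apply: subset_trans VW.
Qed.
HB.instance Definition _ := Order.Le_isPOrder.Build inclusion_display
  clopenBiclosed cb_le_refl cb_le_anti cb_le_trans.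

Lemma cb_leP (U V : clopenBiclosed) :
  reflect (cb_set U `<=` cb_set V) (U <= V).
Proof. exact: asboolP. Qed.

Fact cb_perp_subproof (U : clopenBiclosed) : clopen_biclosed (perpset U).
Proof. by apply: orthospace_perpset; apply: cbP. Qed.
Definition cb_perp (U : clopenBiclosed) := ClopenBiclosed (cb_perp_subproof U).

Fact cb_meet_subproof (U V : clopenBiclosed) :
  clopen_biclosed (cb_set U `&` cb_set V).
Proof.
case: U V => [U [cU bU]] [V [cV bV]]; split; first exact: clopenI.
exact: biclosedI.
Qed.
Definition cb_meet (U V : clopenBiclosed) :=
  ClopenBiclosed (cb_meet_subproof U V).

Fact cb_join_subproof (U V : clopenBiclosed) :
  clopen_biclosed (perpset (perpset (cb_set U `|` cb_set V))).
Proof.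
rewrite perpsetU; apply: orthospace_perpset.
exact: (cbP (cb_meet (cb_perp U) (cb_perp V))).
Qed.
Definition cb_join (U V : clopenBiclosed) :=
  ClopenBiclosed (cb_join_subproof U V).

Fact cb_lexI (U V W : clopenBiclosed) :
  (U <= cb_meet V W) = (U <= V) && (U <= W).
Proof.
apply/cb_leP/andP => [/= UVW|[/cb_leP UV /cb_leP UW] x Ux].
- by split; apply/cb_leP => x /UVW [].
- by split; [apply: UV|apply: UW].
Qed.

Fact cb_leUx (U V W : clopenBiclosed) :
  (cb_join U V <= W) = (U <= W) && (V <= W).
Proof.
apply/cb_leP/andP => [/= UVW|[/cb_leP UW /cb_leP VW] /=].
- by split; apply/cb_leP => x Hx; apply: UVW; apply: sub_perpset2;
    [left|right].
- have [_ ->] := cbP W; do 2!apply: perpset_anti.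
  by move=> x []; [apply: UW|apply: VW].
Qed.

HB.instance Definition _ := Order.POrder_MeetJoin_isLattice.Build
  inclusion_display clopenBiclosed cb_lexI cb_leUx.

Fact cb_bot_subproof : clopen_biclosed (@set0 X).
Proof. by split; [exact: clopen0|rewrite /biclosed perpset0 perpsetT]. Qed.
Definition cb_bot := ClopenBiclosed cb_bot_subproof.

Fact cb_top_subproof : clopen_biclosed [set: X].
Proof. by split; [exact: clopenT|rewrite /biclosed perpsetT perpset0]. Qed.
Definition cb_top := ClopenBiclosed cb_top_subproof.

Fact cb_le0x (U : clopenBiclosed) : cb_bot <= U.
Proof. by apply/cb_leP. Qed.
Fact cb_lex1 (U : clopenBiclosed) : U <= cb_top.
Proof. by apply/cb_leP. Qed.

HB.instance Definition _ :=
  Order.hasBottom.Build inclusion_display clopenBiclosed cb_le0x.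
HB.instance Definition _ :=
  Order.hasTop.Build inclusion_display clopenBiclosed cb_lex1.

Fact cb_perpK : involutive cb_perp.
Proof. by move=> U; apply: cb_eq; have [_ /= <-] := cbP U. Qed.
Fact cb_perp_anti (U V : clopenBiclosed) : U <= V -> cb_perp V <= cb_perp U.
Proof. by move=> /cb_leP UV; apply/cb_leP; apply: perpset_anti. Qed.
Fact cb_meetxoc (U : clopenBiclosed) : (U `&` cb_perp U)%O = \bot.
Proof. by apply: cb_eq; apply: setI_perpset. Qed.
Fact cb_joinxoc (U : clopenBiclosed) : (U `|` cb_perp U)%O = \top.
Proof.
apply: cb_eq; rewrite /= perpsetU.
by rewrite (setI_perpset (perpset _)) perpset0.
Qed.

HB.instance Definition _ := TBLattice_isOrthoLattice.Build inclusion_display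
  clopenBiclosed cb_perpK cb_perp_anti cb_meetxoc cb_joinxoc.

End ClopenBiclosed.

Section ClopenMap.
Context (d d' : Order.disp_t) (P : orthoSpaceType d) (X : orthoSpaceType d').
Variable phi : orthoSpaceMorphism P X.

Lemma osm_preimage_perpset (U : set X) : biclosed U ->
  phi @^-1` perpset U = perpset (phi @^-1` U).
Proof.
move=> bU; apply/seteqP; split=> p /= Up.
- by move=> q /= Uq; apply: (@osm_perp _ _ _ _ phi); apply: Up.
- move=> x Ux; apply: contrapT => /osm_back [q [qp xq]].
  apply: qp; apply: Up => /=; rewrite bU.
  by move: xq; do 2!apply: perpset_anti; move=> _ ->.
Qed.

Fact clopen_map_subproof (U : clopenBiclosed X) :
  clopen_biclosed (phi @^-1` cb_set U).
Proof.
have [cU bU] := cbP U; split.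
- by apply: preimage_clopen => // p; apply: osm_continuous.
- rewrite /biclosed -osm_preimage_perpset// -osm_preimage_perpset -?bU//.
  exact: perpset_biclosed.
Qed.

Definition clopen_map (U : clopenBiclosed X) : clopenBiclosed P :=
  ClopenBiclosed (clopen_map_subproof U).

Fact clopen_map_oc : {morph clopen_map : U / ocompl U}.
Proof.
by move=> U; apply: cb_eq; apply: osm_preimage_perpset; case: (cbP U).
Qed.
Fact clopen_map_le : {homo clopen_map : U V / U <= V}.
Proof. by move=> U V /cb_leP UV; apply/cb_leP => p; apply: UV. Qed.
Fact clopen_mapI : {morph clopen_map : U V / (U `&` V)%O}.
Proof. by move=> U V; apply: cb_eq. Qed.
Fact clopen_mapU : {morph clopen_map : U V / (U `|` V)%O}.
Proof.
move=> U V; apply: cb_eq => /=.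
rewrite osm_preimage_perpset; last exact: perpset_biclosed.
have [[_ bU] [_ bV]] := (cbP U, cbP V).
by rewrite !perpsetU preimage_setI !osm_preimage_perpset.
Qed.
Fact clopen_map0 : clopen_map \bot = \bot. Proof. exact: cb_eq. Qed.
Fact clopen_map1 : clopen_map \top = \top. Proof. exact: cb_eq. Qed.

HB.instance Definition _ := Order.isOrderMorphism.Build _ _ _ _
  clopen_map clopen_map_le.
HB.instance Definition _ := Order.isLatticeMorphism.Build _ _ _ _
  clopen_map clopen_mapI clopen_mapU.
HB.instance Definition _ := Order.isBLatticeMorphism.Build _ _ _ _
  clopen_map clopen_map0.
HB.instance Definition _ := Order.isTLatticeMorphism.Build _ _ _ _
  clopen_map clopen_map1.
HB.instance Definition _ := isOrthoComplMorphism.Build _ _ _ _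
  clopen_map clopen_map_oc.

End ClopenMap.

Definition C_ob (X : os_object) : ol_object :=
  @OLObject inclusion_display (clopenBiclosed X).

Definition C_map (P X : os_object) (phi : orthoSpaceMorphism P X) :
    orthoLatticeMorphism (C_ob X) (C_ob P) :=
  HB.pack_for (orthoLatticeMorphism (C_ob X) (C_ob P)) (clopen_map phi).

Fact C_map_id (X : os_object) : C_map (os_id X) = ol_id (C_ob X).
Proof. by apply: olm_eq => U; apply: cb_eq. Qed.

Fact C_map_comp (P X Y : os_object) (g : orthoSpaceMorphism X Y)
    (f : orthoSpaceMorphism P X) :
  C_map (os_comp g f) = ol_comp (C_map f) (C_map g).
Proof. by apply: olm_eq => U; apply: cb_eq. Qed.

Definition C_functor : functor (opposite OS) OL :=
  @Functor (opposite OS) OL C_ob (fun X P => @C_map P X)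
    C_map_id (fun Y X P g f => C_map_comp f g).

Section OrthoLatticeTheory.
Context (d : Order.disp_t) (L : orthoLatticeType d).
Implicit Types a b : L.

Lemma ocompl_le a b : (ocompl a <= ocompl b) = (b <= a).
Proof.
apply/idP/idP => [/ocompl_anti|]; last exact: ocompl_anti.
by rewrite !ocomplK.
Qed.

Lemma ocompl0 : ocompl \bot = \top :> L.
Proof. by have := joinxoc (\bot : L); rewrite join0x. Qed.

Lemma ocompl1 : ocompl \top = \bot :> L.
Proof. by rewrite -ocompl0 ocomplK. Qed.

Lemma ocomplU a b : ocompl (a `|` b)%O = (ocompl a `&` ocompl b)%O.
Proof.
apply: le_anti; rewrite lexI !ocompl_le leUl leUr /=.
rewrite -[leLHS]ocomplK ocompl_le leUx.
by rewrite -[X in X <= _]ocomplK ocompl_le leIl /=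
  -[X in X <= _]ocomplK ocompl_le leIr.
Qed.

End OrthoLatticeTheory.

Section ProperFilters.
Context (d : Order.disp_t) (L : orthoLatticeType d).

Record properFilter := ProperLFilter {
  pf_set :> set L;
  pf_neq0 : pf_set !=set0;
  pf_proper : pf_set <> setT;
  pf_up : forall a b : L, pf_set a -> a <= b -> pf_set b;
  pf_meet : forall a b : L, pf_set a -> pf_set b -> pf_set (a `&` b)%O
}.
Implicit Types (x y z : properFilter) (a b : L).

Lemma pf_eq x y : pf_set x = pf_set y -> x = y.
Proof.
case: x => x x1 x2 x3 x4; case: y => y y1 y2 y3 y4 /= xy; subst y.
by congr ProperLFilter.
Qed.

Lemma pf_top x : pf_set x \top.
Proof. by have [a xa] := pf_neq0 x; apply: pf_up xa (lex1 a). Qed.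

Lemma pf_bot x : ~ pf_set x \bot.
Proof.
move=> x0; apply: (@pf_proper x); apply/seteqP; split=> // a _.
exact: pf_up x0 (le0x a).
Qed.

HB.instance Definition _ := gen_eqMixin properFilter.
HB.instance Definition _ := gen_choiceMixin properFilter.

Definition pf_le x y : bool := `[< pf_set x `<=` pf_set y >].

Fact pf_le_refl : reflexive pf_le. Proof. by move=> x; apply/asboolP. Qed.
Fact pf_le_anti : antisymmetric pf_le.
Proof.
by move=> x y /andP[/asboolP xy /asboolP yx]; apply: pf_eq; apply/seteqP.
Qed.
Fact pf_le_trans : transitive pf_le.
Proof.
move=> y x z /asboolP xy /asboolP yz.
by apply/asboolP; apply: subset_trans yz.
Qed.
HB.instance Definition _ := Order.Le_isPOrder.Build inclusion_display
  properFilter pf_le_refl pf_le_anti pf_le_trans.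

Lemma pf_leP x y : reflect (pf_set x `<=` pf_set y) (x <= y).
Proof. exact: asboolP. Qed.

Definition pf_basic a : set properFilter := [set x | pf_set x a].

Definition pf_subbase : set (set properFilter) :=
  [set A | exists a, A = pf_basic a \/ A = ~` pf_basic a].

HB.instance Definition _ :=
  isSubBaseTopological.Build properFilter pf_subbase id.

Definition pf_perp x y : Prop :=
  exists a, [/\ a <> \bot, pf_set x a & pf_set y (ocompl a)].

Fact pf_perp_irr x : ~ pf_perp x x.
Proof.
move=> [a [_ xa xa']]; apply: (@pf_bot x).
by rewrite -(meetxoc a); apply: pf_meet.
Qed.

Fact pf_perp_sym x y : pf_perp x y -> pf_perp y x.
Proof.
move=> [a [_ xa ya']]; exists (ocompl a); rewrite ocomplK; split=> // a0.
by apply: (@pf_bot y); rewrite -a0.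
Qed.

HB.instance Definition _ := isOrthoFrame.Build properFilter
  pf_perp_irr pf_perp_sym.

Lemma pf_perpP x y : perp x y <-> exists2 a, pf_set x a & pf_set y (ocompl a).
Proof.
split=> [[a [_ xa ya']]|[a xa ya']]; first by exists a.
by exists a; split=> // a0; apply: (@pf_bot x); rewrite -a0.
Qed.

Lemma open_pf_subbase (A : set properFilter) : pf_subbase A -> open A.
Proof.
move=> sA; exists [set A]; last by rewrite bigcup_set1.
move=> _ ->; exists [fset A]%fset.
  by move=> B /fset1P ->; rewrite inE.
apply/seteqP; split=> x /=; first by move/(_ A); apply; apply/fset1P.
by move=> Ax B /fset1P ->.
Qed.

Lemma pf_basic_clopen a : clopen (pf_basic a).
Proof.
split; first by apply: open_pf_subbase; exists a; left.
by rewrite -openC; apply: open_pf_subbase; exists a; right.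
Qed.

Lemma cvg_pf (G : set_system properFilter) x : Filter G ->
  (forall A, pf_subbase A -> A x -> G A) -> G --> x.
Proof.
move=> FG GA A; rewrite nbhsE => -[B [Bop Bx] sBA].
apply: filterS sBA _; case: Bop Bx => D sD <- [C DC Cx].
apply: (@filterS _ _ _ C); first by move=> y Cy; exists C.
have [E sE EC] := sD _ DC.
rewrite -EC; apply: filter_bigI => B' B'E.
apply: GA; first by have := sE _ B'E; rewrite inE.
by move: Cx; rewrite -EC; apply.
Qed.

Fact pf_compact : compact [set: properFilter].
Proof.
rewrite compact_ultra => G UG _.
have PG : ProperFilter G by exact: ultra_proper.
pose u : set L := [set a | G (pf_basic a)].
have u1 : u \top by apply: filterS filterT => x _; apply: pf_top.
have u0 : ~ u \bot.
  move=> u0; apply: (@filter_not_empty _ G).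
  by apply: filterS u0 => x /pf_bot.
have uup a b : u a -> a <= b -> u b.
  by move=> ua ab; apply: filterS ua => x xa; apply: pf_up ab.
have uI a b : u a -> u b -> u (a `&` b)%O.
  move=> ua ub; apply: filterS (filterI ua ub) => x [xa xb].
  exact: pf_meet.
have uT : u <> setT by move=> uT; apply: u0; rewrite uT.
exists (@ProperLFilter u (ex_intro _ _ u1) uT uup uI); split=> //=.
apply: cvg_pf => _ [a [->//|->]] nua.
by have [//|] := in_ultra_setVsetC (pf_basic a) UG.
Qed.

Definition pf_principal a (a0 : a <> \bot) : properFilter.
Proof.
refine (@ProperLFilter [set b | a <= b] _ _ _ _).
- by exists a => /=.
- move=> aT; apply: a0; apply/eqP; rewrite -lex0.
  by have : [set b | a <= b] \bot by rewrite aT.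
- by move=> b c /= ab bc; apply: le_trans bc.
- by move=> b c /= ab ac; rewrite lexI ab.
Defined.

Lemma perpset_pf_basic a : perpset (pf_basic a) = pf_basic (ocompl a).
Proof.
apply/seteqP; split=> [y ay|y ya' x xa]; last by apply/pf_perpP; exists a.
rewrite /pf_basic /=; have [->|/eqP a0] := eqVneq a \bot.
  by rewrite ocompl0; apply: pf_top.
have /pf_perpP[b /= ab yb'] : perp (pf_principal a0) y by apply: ay => /=.
by apply: pf_up yb' _; rewrite ocompl_le.
Qed.

Lemma pf_basic_cb a : clopen_biclosed (pf_basic a).
Proof.
split; first exact: pf_basic_clopen.
by rewrite /biclosed !perpset_pf_basic ocomplK.
Qed.

Lemma cb_pf_basic (U : set properFilter) : clopen_biclosed U ->
  exists a, U = pf_basic a.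
Proof.
move=> [cU bU]; have compU (V : set properFilter) : clopen V -> near_covering V.
  move=> [_ clV]; apply/compact_near_coveringP.
  exact: (subclosed_compact clV pf_compact).
have sepU x : ~ U x -> exists2 a, U `<=` pf_basic a & ~ pf_set x a.
  rewrite {1}bU => /existsNP [z /not_implyP [Uz zx]].
  pose up a : set L := [set b | a <= b /\ pf_set z (ocompl b)].
  pose G : set_system L := filter_from [set a | pf_set z (ocompl a)] up.
  have FG : ProperFilter G.
    apply: filter_from_proper; last by move=> a za; exists a; split.
    apply: filter_from_filter.
      by exists \bot; rewrite /= ocompl0; apply: pf_top.
    move=> a b za zb; exists (a `|` b)%O.
      by rewrite /= ocomplU; apply: pf_meet.
    by move=> c [abc zc]; move: abc; rewrite leUx => /andP[].
  have [v Uv|a za' Ha] := compU U cU L G (fun a x => pf_set x a) _.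
    have /pf_perpP[a va za'] := Uz _ Uv.
    exists (pf_basic a, up a); last first.
      by move=> [w c] /= [wa [ac _]]; apply: pf_up ac.
    split=> /=; last by exists a.
    by apply: open_nbhs_nbhs; split=> //; case: (pf_basic_clopen a).
  exists a; first exact: (Ha a).
  by move=> xa; apply: zx; apply: perp_sym; apply/pf_perpP; exists a.
pose down a : set L := [set b | b <= a /\ U `<=` pf_basic b].
pose G : set_system L := filter_from [set a | U `<=` pf_basic a] down.
have FG : Filter G.
  apply: filter_from_filter; first by exists \top => x _; apply: pf_top.
  move=> a b Ua Ub; exists (a `&` b)%O.
    by move=> x Ux; apply: pf_meet; [apply: Ua|apply: Ub].
  by move=> c [+ Uc]; rewrite lexI => /andP[].
have [|x nUx|a Ua Ha] := compU (~` U) _ L G (fun a x => ~ pf_set x a) _.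
- exact: clopenC.
- have [a Ua xa] := sepU _ nUx.
  exists (~` pf_basic a, down a); last first.
    by move=> [w c] /= [wa [ca _]] wc; apply: wa; apply: pf_up ca.
  split=> /=; last by exists a.
  apply: open_nbhs_nbhs; split=> //.
  by have [_ /closed_openC] := pf_basic_clopen a.
exists a; apply/seteqP; split=> // x xa.
by apply: contrapT => nUx; apply: (Ha a) xa.
Qed.

Fact pf_sep x y : ~ (x <= y) ->
  exists U : set properFilter, [/\ clopen_biclosed U, U x & ~ U y].
Proof.
move=> xy; have /existsNP [a /not_implyP [xa ya]] :
    ~ pf_set x `<=` pf_set y by move=> /pf_leP.
by exists (pf_basic a); split=> //; apply: pf_basic_cb.
Qed.

Fact pf_perp_le x y z : perp x z -> x <= y -> perp y z.
Proof.
move=> /pf_perpP[a xa za'] /pf_leP xy; apply/pf_perpP.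
by exists a => //; apply: xy.
Qed.

Fact pf_perpset (U : set properFilter) :
  clopen_biclosed U -> clopen_biclosed (perpset U).
Proof.
by move=> /cb_pf_basic [a ->]; rewrite perpset_pf_basic; apply: pf_basic_cb.
Qed.

Fact pf_perp_sep x y : perp x y ->
  exists U : set properFilter, [/\ clopen_biclosed U, U x & perpset U y].
Proof.
move=> /pf_perpP[a xa ya']; exists (pf_basic a).
by rewrite perpset_pf_basic; split=> //; apply: pf_basic_cb.
Qed.

HB.instance Definition _ := OrthoPreSpace_isOrthoSpace.Build
  inclusion_display properFilter
  pf_compact pf_sep pf_perp_le pf_perpset pf_perp_sep.

End ProperFilters.

Section FilterMap.
Context (d d' : Order.disp_t) (L : orthoLatticeType d).
Context (M : orthoLatticeType d') (f : orthoLatticeMorphism L M).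

Definition filter_map (x : properFilter M) : properFilter L.
Proof.
refine (@ProperLFilter _ _ (f @^-1` pf_set x) _ _ _ _).
- by exists \top; rewrite /= omorph1; apply: pf_top.
- move=> fT; apply: (@pf_bot _ _ x); rewrite -(omorph0 f).
  by have : (f @^-1` pf_set x) \bot by rewrite fT.
- by move=> a b /= xa ab; apply: pf_up xa _; apply: omorph_le.
- by move=> a b /= xa xb; rewrite omorphI; apply: pf_meet.
Defined.

Fact filter_map_continuous : continuous filter_map.
Proof.
move=> x; have Fx : Filter (filter_map @ nbhs x) by exact: fmap_filter.
apply: cvg_pf => A [a sA] fxA; have [ofa cfa] := pf_basic_clopen (f a).
case: sA fxA => -> fxA; apply: open_nbhs_nbhs; split=> //.
exact: (closed_openC cfa).
Qed.

Fact filter_map_perp (p q : properFilter M) :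
  perp (filter_map p) (filter_map q) -> perp p q.
Proof.
move=> /pf_perpP[a /= pa qa']; apply/pf_perpP.
by exists (f a) => //; rewrite -omorphoc.
Qed.

Fact filter_map_back (x : properFilter L) (p : properFilter M) :
  ~ perp x (filter_map p) ->
  exists q, ~ perp q p /\ perpset (perpset [set x]) (filter_map q).
Proof.
move=> xp; have fx a b : pf_set x a -> pf_set p b -> ~ (f a <= ocompl b).
  move=> xa pb fab; apply: xp; apply/pf_perpP; exists a => //=.
  by rewrite omorphoc; apply: pf_up pb _; rewrite -ocompl_le ocomplK.
pose Q : set M := [set b | exists2 a, pf_set x a & f a <= b].
have Q0 : Q !=set0 by exists (f \top), \top; first exact: pf_top.
have Qp : Q <> setT.
  move=> QT; have [a xa fa0] : Q \bot by rewrite QT.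
  by apply: fx xa (pf_top p) _; rewrite ocompl1.
have Qu a b : Q a -> a <= b -> Q b.
  by move=> [c xc ca] ab; exists c => //; apply: le_trans ab.
have Qm a b : Q a -> Q b -> Q (a `&` b)%O.
  move=> [a' xa aa] [b' xb bb]; exists (a' `&` b')%O; first exact: pf_meet.
  by rewrite omorphI; apply: leI2.
exists (ProperLFilter Q0 Qp Qu Qm); split.
  move=> /pf_perpP[b /= [a xa ab] pb']; apply: fx xa pb' _.
  by rewrite ocomplK.
apply/perpset2_1P => z /pf_perpP[a xa za'].
apply: perp_sym; apply/pf_perpP; exists a => //=.
by exists a.
Qed.

End FilterMap.

Definition F_ob (L : ol_object) : os_object :=
  @OSObject inclusion_display (properFilter L).

Definition F_map (L M : ol_object) (f : orthoLatticeMorphism L M) :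
    orthoSpaceMorphism (F_ob M) (F_ob L) :=
  @OrthoSpaceMorphism _ (F_ob M) _ (F_ob L) (filter_map f)
    (@filter_map_continuous _ _ _ _ f) (@filter_map_perp _ _ _ _ f)
    (@filter_map_back _ _ _ _ f).

Fact F_map_id (L : ol_object) : F_map (ol_id L) = os_id (F_ob L).
Proof. by apply: osm_eq => x; apply: pf_eq. Qed.

Fact F_map_comp (L M N : ol_object) (g : orthoLatticeMorphism M N)
    (f : orthoLatticeMorphism L M) :
  F_map (ol_comp g f) = os_comp (F_map f) (F_map g).
Proof. by apply: osm_eq => x; apply: pf_eq. Qed.

Definition F_functor : functor OL (opposite OS) :=
  @Functor OL (opposite OS) F_ob F_map F_map_id F_map_comp.

(* Main.v *)
From HB Require Import structures.
From mathcomp Require Import all_boot all_order.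
From mathcomp Require Import all_classical.
From mathcomp Require Import topology.
Require Import Defs.

Set Implicit Arguments.
Unset Strict Implicit.
Unset Printing Implicit Defensive.

Import Order.Theory.

Local Open Scope order_scope.
Local Open Scope classical_set_scope.

(** Both transposes read the single relation [p \in f a] between points [p]
    of [X] and elements [a] of [L]: an ortholattice homomorphism lists, for
    each [a], the clopen set of related points, and an orthospace morphism
    lists, for each [p], the filter of related elements. The transposes are
    built from the two units of the adjunction. The Stone map sends [a] to
    the set of filters containing [a]; the evaluation map [X -> F (C X)] sends
    a point to the filter of clopen bi-orthogonally closed sets containing it.
    Since both adjunction bijections are obtained by composing with these
    maps, mutual inverseness and naturality hold by unfolding.

    The mathematical content is therefore that the units are morphisms. For
    the Stone map, the computation [perpset_pf_basic] of the orthocomplement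
    of a basic set gives preservation of joins through de Morgan. For the
    evaluation map, the back condition asks, given a filter [x] of clopen sets
    that is not orthogonal to the image of [p], for a point [q]
    in every member of [x] with [q] not orthogonal to [p]; such a [q] comes
    from compactness ([compact_filter_meet]), because the points not
    orthogonal to [p] form a closed set ([closed_nonperp]). *)

(** * The Stone map of an ortholattice *)

Section StoneMap.
Context (d : Order.disp_t) (L : orthoLatticeType d).
Implicit Types a b : L.

Lemma pf_basicI a b : pf_basic (a `&` b)%O = pf_basic a `&` pf_basic b.
Proof.
apply/seteqP; split=> [x xab|x [xa xb]]; last exact: pf_meet.
by split; apply: pf_up xab _; rewrite ?leIl ?leIr.
Qed.

Lemma pf_basicU a b :
  pf_basic (a `|` b)%O = perpset (perpset (pf_basic a `|` pf_basic b)).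
Proof.
by rewrite perpsetU !perpset_pf_basic -pf_basicI -ocomplU perpset_pf_basic
  ocomplK.
Qed.

Definition stone_map a : clopenBiclosed (properFilter L) :=
  ClopenBiclosed (pf_basic_cb a).

Fact stone_map_le : {homo stone_map : a b / a <= b}.
Proof. by move=> a b ab; apply/cb_leP => x xa; apply: pf_up ab. Qed.
Fact stone_mapI : {morph stone_map : a b / (a `&` b)%O}.
Proof. by move=> a b; apply: cb_eq; apply: pf_basicI. Qed.
Fact stone_mapU : {morph stone_map : a b / (a `|` b)%O}.
Proof. by move=> a b; apply: cb_eq; apply: pf_basicU. Qed.
Fact stone_map0 : stone_map \bot = \bot.
Proof. by apply: cb_eq; apply/seteqP; split=> // x /pf_bot. Qed.
Fact stone_map1 : stone_map \top = \top.
Proof. by apply: cb_eq; apply/seteqP; split=> // x _; apply: pf_top. Qed.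
Fact stone_map_oc : {morph stone_map : a / ocompl a}.
Proof. by move=> a; apply: cb_eq; rewrite /= perpset_pf_basic. Qed.

HB.instance Definition _ := Order.isOrderMorphism.Build _ _ _ _
  stone_map stone_map_le.
HB.instance Definition _ := Order.isLatticeMorphism.Build _ _ _ _
  stone_map stone_mapI stone_mapU.
HB.instance Definition _ := Order.isBLatticeMorphism.Build _ _ _ _
  stone_map stone_map0.
HB.instance Definition _ := Order.isTLatticeMorphism.Build _ _ _ _
  stone_map stone_map1.
HB.instance Definition _ := isOrthoComplMorphism.Build _ _ _ _
  stone_map stone_map_oc.

End StoneMap.

Definition stone (L : ol_object) : orthoLatticeMorphism L (C_ob (F_ob L)) :=
  HB.pack_for (orthoLatticeMorphism L (C_ob (F_ob L))) (@stone_map _ L).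

(** * The evaluation map of an orthospace *)

Section Evaluation.
Context (d : Order.disp_t) (X : orthoSpaceType d).
Implicit Types (p q : X) (U V : clopenBiclosed X).

(** Separation of orthogonal points makes orthogonality to [p] an open
    condition: a clopen set [U] with [q] in [U] and [p] in its orthocomplement
    is a neighbourhood of [q] whose points are all orthogonal to [p]. *)
Lemma closed_nonperp p : closed [set q | ~ perp q p].
Proof.
rewrite -openC openE => q /= /contrapT /orthospace_perp_sep.
move=> [U [[[oU _] _] Uq Up]].
apply: filterS (open_nbhs_nbhs (conj oU Uq)) => r Ur /=.
by apply; apply: Up.
Qed.

(** The members of the filter [x] cut down to a closed set [K] are a downward
    directed family of non-empty closed sets, so compactness gives them a
    common point. *)
Lemma compact_filter_meet (x : properFilter (clopenBiclosed X)) (K : set X) :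
  closed K -> (forall U, pf_set x U -> cb_set U `&` K !=set0) ->
  exists2 q, K q & forall U, pf_set x U -> cb_set U q.
Proof.
move=> cK xK.
pose G : set_system X :=
  filter_from (pf_set x) (fun U => cb_set U `&` K).
have GG : ProperFilter G.
  apply: filter_from_proper => //.
  apply: filter_from_filter; first exact: pf_neq0.
  move=> U V xU xV; exists (U `&` V)%O; first exact: pf_meet.
  by move=> q [[Uq Vq] Kq].
have [q [_ Gq]] := orthospace_compact _ GG filterT.
have memq A : closed A -> G A -> A q.
  by move=> cA GA; apply: cA => B Bq; apply: Gq.
exists q => [|U xU].
  by apply: memq => //; exists \top; [apply: pf_top|move=> r []].
have [[_ cU] _] := cbP U.
by apply: memq => //; exists U => // r [].
Qed.

Definition eval_filter p : properFilter (clopenBiclosed X).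
Proof.
refine (@ProperLFilter _ _ [set U | cb_set U p] _ _ _ _).
- by exists \top.
- by move=> eT; have : [set U | cb_set U p] \bot by rewrite eT.
- by move=> U V /= Up /cb_leP; apply.
- by move=> U V.
Defined.

Fact eval_continuous : continuous eval_filter.
Proof.
move=> p; have Fp : Filter (eval_filter @ nbhs p) by exact: fmap_filter.
apply: cvg_pf => A [U sA] pA; have [[oU cU] _] := cbP U.
case: sA pA => -> pA; apply: open_nbhs_nbhs; split=> //.
exact: (closed_openC cU).
Qed.

Fact eval_perp p q : perp (eval_filter p) (eval_filter q) -> perp p q.
Proof. by move=> /pf_perpP[U Up]; apply. Qed.

(** If some [U] in [x] had only points orthogonal to [p], then [p] would lie
    in its orthocomplement and [U] would witness that [x] is orthogonal to the
    filter of [p]. So compactness applies, and the point [q] that it gives has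
    a filter above [x], hence in the bi-orthogonal closure of [x]. *)
Fact eval_back (x : properFilter (clopenBiclosed X)) p :
  ~ perp x (eval_filter p) ->
  exists q, ~ perp q p /\ perpset (perpset [set x]) (eval_filter q).
Proof.
move=> xp; have [U xU|q qp xq] := @compact_filter_meet x _ (@closed_nonperp p).
  apply: contrapT => U0; apply: xp; apply/pf_perpP; exists U => //= r Ur.
  by apply: contrapT => rp; apply: U0; exists r.
exists q; split=> //; apply/perpset2_1P => z xz; apply: perp_sym.
by apply: orthospace_perp_le xz _; apply/pf_leP.
Qed.

End Evaluation.

Definition evaluation (X : os_object) : orthoSpaceMorphism X (F_ob (C_ob X)) :=
  @OrthoSpaceMorphism _ X _ (F_ob (C_ob X)) (@eval_filter _ X)
    (@eval_continuous _ X) (@eval_perp _ X) (@eval_back _ X).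

(** * The adjunction *)

Definition ol_transpose (L : ol_object) (X : os_object)
    (h : orthoSpaceMorphism X (F_ob L)) : orthoLatticeMorphism L (C_ob X) :=
  ol_comp (C_map h) (stone L).

Definition os_transpose (L : ol_object) (X : os_object)
    (f : orthoLatticeMorphism L (C_ob X)) : orthoSpaceMorphism X (F_ob L) :=
  os_comp (F_map f) (evaluation X).

Lemma ol_transposeK (L : ol_object) (X : os_object) :
  cancel (@ol_transpose L X) (@os_transpose L X).
Proof. by move=> h; apply: osm_eq => p; apply: pf_eq. Qed.

Lemma os_transposeK (L : ol_object) (X : os_object) :
  cancel (@os_transpose L X) (@ol_transpose L X).
Proof. by move=> f; apply: olm_eq => a; apply: cb_eq. Qed.

Theorem theorem4p8 : left_adjoint F_functor C_functor.
Proof.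
exists ol_transpose; split=> [L X|L L' X X' u v h].
  exact: Bijective (@ol_transposeK L X) (@os_transposeK L X).
by apply: olm_eq => a; apply: cb_eq.
Qed.
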